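(* Let $n$ be a positive integer, $k\ge 0$ an integer, and $0\le j\le n$ an integer. Define \[ c_{n,k}(j)=\sum_{i=0}^{k}(-1)^i(k+1-i)^{n-j}(k-i)^j\binom{n+1}{i} \] (with the convention $0^0=1$). Then \[ c_{n,k}(j)=\#\{\pi\in W_{n,k+1} : j<Q_n(\pi)\le n\}+\#\{\pi\in W_{n,k} : 1\le Q_n(\pi)\le j\}. \]
   Context: For a permutation $\pi=p_1p_2\ldots p_n$ of $[n]=\{1,\dots,n\}$ (in one-line notation), an index $i$ is a weak excedance of $\pi$ if $p_i\ge i$. $W_{n,m}$ denotes the set of permutations of $[n]$ with exactly $m$ weak excedances (empty if $m=0$ or $m>n$). $Q_n(\pi)$ denotes the index $i$ with $p_i=n$. The numbers $c_{n,k}(j)$ arise as coefficients in the expansion $A_{n,k}(a,d)=\sum_{i=0}^{k}(-1)^i[(k+1-i)d-a]^n\binom{n+1}{i}=\sum_{j=0}^n c_{n,k}(j)\binom{n}{j}(d-a)^{n-j}a^j$ of the general Eulerian numbers. *)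

(* Defs.v *)
From mathcomp Require Import all_boot all_order all_algebra all_fingroup.

Set Implicit Arguments.
Unset Strict Implicit.
Unset Printing Implicit Defensive.

Import GRing.Theory Num.Theory.

(* Permutations of [n] = {1, ..., n} are elements of 'S_n, i.e. permutations
   of {0, ..., n.-1}: the ordinal i stands for i.+1, both as an index and as a
   value. *)

Definition weak_excedances (n : nat) (s : 'S_n) : {set 'I_n} :=
  [set i : 'I_n | i <= s i].

Definition W (n m : nat) : {set 'S_n} :=
  [set s : 'S_n | #|weak_excedances s| == m].

(* The 1-based index at which s takes its largest value. It exists and is
   unique as soon as 0 < n; the value 0 is only reached for n = 0. *)
Definition Q (n : nat) (s : 'S_n) : nat :=
  if [pick i : 'I_n | (s i).+1 == n] is Some i then i.+1 else 0.

(* All subtractions of bases take place in int; x ^+ 0 = 1 for every x,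
   including x = 0. *)
Definition c (n k j : nat) : int :=
  (\sum_(0 <= i < k.+1)
     (-1) ^+ i * (k%:Z + 1 - i%:Z) ^+ (n - j)%N * (k%:Z - i%:Z) ^+ j
       * ('C(n.+1, i))%:Z)%R.

(* Main.v *)
(* Let a(n, m, q) be the number of permutations of [n] with m weak excedances
   whose maximum is at position q. The theorem follows by telescoping over j from
   a(n, k + 1, j) = c_(n-1, k)(j - 1), because Pascal's rule gives
     c_(n, k)(j - 1) - c_(n, k)(j) = c_(n-1, k)(j - 1) - c_(n-1, k-1)(j - 1).
   That formula for a is proved by induction on n and downward induction on j: both
   sides satisfy the recurrence a(n, m, j + 1) - a(n, m, j) =
   a(n-1, m-1, j) - a(n-1, m, j), which comes from exchanging the entries at the
   positions j and j + 1, and at j = n both count the permutations of [n - 1] with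
   m - 1 weak excedances. *)
Require Import Defs.
From mathcomp Require Import all_boot all_order all_algebra all_fingroup.
From mathcomp Require Import zify ring.

Set Implicit Arguments.
Unset Strict Implicit.
Unset Printing Implicit Defensive.

Import GRing.Theory.

(** * Alternating binomial sums and the recurrences of [c] *)

Section Algebra.
Local Open Scope ring_scope.

(** This is the coefficient of [x^k] in [(1 - x)^m] times the series of all [f(l) x^l] with
    [l >= 0]; raising [m] by one multiplies by [1 - x]. *)
Definition binomial_conv (f : int -> int) (m k : nat) : int :=
  \sum_(0 <= i < k.+1) (-1) ^+ i * f (k%:Z - i%:Z) * ('C(m, i))%:Z.

Lemma binomial_conv0 f m : binomial_conv f m 0 = f 0.
Proof. by rewrite /binomial_conv big_nat1 bin0 expr0 mul1r mulr1. Qed.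

Lemma binomial_conv_bin0 f k : binomial_conv f 0 k = f k.
Proof.
rewrite /binomial_conv big_nat_recl // big1_seq ?addr0 => [|i _].
  by rewrite bin0 expr0 mul1r mulr1; congr f; lia.
by rewrite bin0n mulr0.
Qed.

Lemma binomial_convS f m k :
  binomial_conv f m.+1 k.+1 = binomial_conv f m k.+1 - binomial_conv f m k.
Proof.
rewrite /binomial_conv !(big_nat_recl k.+1) //= !bin0 -addrA; congr (_ + _).
rewrite -sumrB; apply: eq_bigr => i _.
rewrite binS PoszD exprS (_ : k.+1%:Z - i.+1%:Z = k%:Z - i%:Z); last by lia.
ring.
Qed.

Lemma binomial_convB f g m k :
  binomial_conv (fun x => f x - g x) m k = binomial_conv f m k - binomial_conv g m k.
Proof. by rewrite /binomial_conv -sumrB; apply: eq_bigr => i _; ring. Qed.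

Lemma eq_binomial_conv f g m k : f =1 g -> binomial_conv f m k = binomial_conv g m k.
Proof. by move=> fg; apply: eq_bigr => i _; rewrite fg. Qed.

Lemma cE n k j :
  c n k j = binomial_conv (fun x => (x + 1) ^+ (n - j) * x ^+ j) n.+1 k.
Proof.
apply: eq_bigr => i _; rewrite -!mulrA; congr (_ * (_ ^+ _ * _)); ring.
Qed.

(* This is c_(n, m-1)(q), where c_(n, -1) = 0. *)
Definition cpred (n m q : nat) : int := if m is k.+1 then c n k q else 0.

(** Since [(x + 1) - x = 1], the two summands differ by [(x + 1)^(n-q) x^q], the summand of
    [c n _ q]; Pascal's rule then lowers the binomial row by one. *)
Lemma c_diff n k q : (q <= n)%N ->
  c n.+1 k q - c n.+1 k q.+1 = cpred n k.+1 q - cpred n k q.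
Proof.
move=> le_qn; rewrite !cE -binomial_convB.
rewrite (@eq_binomial_conv _ (fun x => (x + 1) ^+ (n - q) * x ^+ q)); last first.
  by move=> x; rewrite subSS subSn // !exprS; ring.
by case: k => [|k] /=; rewrite !cE ?binomial_conv0 ?subr0 // binomial_convS.
Qed.

Lemma c_telescope n k j : (j <= n.+1)%N ->
  c n.+1 k j = c n.+1 k 0 + \sum_(0 <= q < j) (cpred n k q - cpred n k.+1 q).
Proof.
elim: j => [|j IHj] lt_jn; first by rewrite big_geq // addr0.
rewrite big_nat_recr //= addrA -IHj; last exact: ltnW.
by have := @c_diff n k j lt_jn; rewrite /= => /(canRL (subrK _)) ->; ring.
Qed.

Lemma c_shift n k : c n.+1 k.+1 n.+1 = c n.+1 k 0.
Proof.
rewrite /c big_nat_recr //= subrr expr0n /= !(mul0r, mulr0) addr0.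
apply: eq_bigr => i _; rewrite subnn subn0 !expr0 !mulr1.
by congr (_ * _ ^+ _ * _); lia.
Qed.

Lemma c_top0 n : c n.+1 0 n.+1 = 0.
Proof. by rewrite cE binomial_conv0 exprS mul0r mulr0. Qed.

(** Telescoping up to [j = n + 1] ends at a value that [c_shift] identifies with the case [k - 1] at
    [j = 0], so the identity passes from each [k] to the next. *)
Lemma c_sum n k : c n.+1 k 0 = \sum_(0 <= q < n.+1) c n k q.
Proof.
elim: k => [|k IHk].
  have := @c_telescope n 0 n.+1 (leqnn _); rewrite c_top0 => /esym/eqP.
  rewrite addr_eq0 => /eqP ->; rewrite -sumrN.
  by apply: eq_bigr => i _; rewrite /= sub0r opprK.
have := @c_telescope n k.+1 n.+1 (leqnn _).
rewrite c_shift IHk sumrB addrCA -[LHS]addr0 => /addrI/esym/eqP.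
by rewrite subr_eq0 => /eqP.
Qed.

Lemma c_split n k j : (j <= n.+1)%N ->
  c n.+1 k j = \sum_(j <= q < n.+1) cpred n k.+1 q + \sum_(0 <= q < j) cpred n k q.
Proof.
move=> le_jn; rewrite c_telescope // c_sum (big_cat_nat _ le_jn) //= sumrB; ring.
Qed.

End Algebra.

(** * Deleting and exchanging entries of permutations *)

Section Permutations.
Local Open Scope group_scope.

Lemma card_perm_fixing n (P : pred 'S_n.+1) (i j : 'I_n.+1) :
  #|[set s : 'S_n.+1 | (s i == j) && P s]| = #|[set t : 'S_n | P (lift_perm i j t)]|.
Proof.
have lift_perm_inj : injective (@lift_perm n i j).
  move=> t u /permP tu; apply/permP => k; apply: (@lift_inj _ j).
  by have := tu (lift i k); rewrite !lift_perm_lift.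
rewrite -(card_imset _ lift_perm_inj).
apply: eq_card => s; rewrite inE; apply/andP/imsetP => [[/eqP sij Ps]|[t]].
  have neq k : s (lift i k) != j by rewrite -sij (inj_eq perm_inj) eq_sym neq_lift.
  (* The default [k] is never taken, because [s (lift i k)] differs from [j]. *)
  pose f k := odflt k (unlift j (s (lift i k))).
  have fE k : lift j (f k) = s (lift i k).
    rewrite /f; case: unliftP => [l -> //|/eqP]; by rewrite (negPf (neq k)).
  have f_inj : injective f.
    by move=> k l /(congr1 (lift j)); rewrite !fE => /perm_inj/lift_inj.
  have st : s = lift_perm i j (perm f_inj).
    apply/permP => k; case: (unliftP i k) => [l ->|->].
      by rewrite lift_perm_lift permE fE.
    by rewrite lift_perm_id.
  by exists (perm f_inj); rewrite // inE -st.
by rewrite inE => Pt ->; rewrite lift_perm_id eqxx.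
Qed.

(** Positions from [i] on and values from [j] on move up by one. For [i = j] this preserves all
    comparisons. For [i = j + 1] the index [j] stays put, but whether its value is at least [j] does
    not change. *)
Lemma weak_excedances_lift n (i j : 'I_n.+1) (t : 'S_n) : j <= i <= j.+1 ->
  #|weak_excedances (lift_perm i j t)| = (i == j) + #|weak_excedances t|.
Proof.
move=> /andP[le_ji le_ij].
have -> : weak_excedances (lift_perm i j t) =
    (if i == j then [set i] else set0) :|: lift i @: weak_excedances t.
  apply/setP => k; rewrite !inE; case: (unliftP i k) => [l ->|->].
    rewrite lift_perm_lift mem_imset ?inE; last exact: lift_inj.
    rewrite [X in X || _](_ : _ = false).
      by rewrite /= /bump; lia.
    by case: eqP => _; rewrite inE // eq_sym (negPf (neq_lift _ _)).
  rewrite lift_perm_id; case: eqP => [<-|ne_ij]; first by rewrite leqnn inE eqxx.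
  rewrite inE /=; case: imsetP => [[l _ /eqP]|_]; first by rewrite (negPf (neq_lift _ _)).
  by apply/negbTE; rewrite -ltnNge ltn_neqAle le_ji andbT eq_sym; apply/eqP => /val_inj.
rewrite cardsU card_imset; last exact: lift_inj.
rewrite [X in _ - X](_ : _ = 0).
  by rewrite subn0; case: eqP => _; rewrite ?cards1 ?cards0.
apply/eqP; rewrite cards_eq0 -subset0; apply/subsetP => x.
case: (i == j); rewrite !inE // => /andP[/eqP-> /imsetP[l _ /eqP]].
by rewrite (negPf (neq_lift _ _)).
Qed.

(* Positions are counted from 0 here, and permutations have n.+1 letters, so that
   [nb n m q] is matched by [c n m.-1 q]. *)
Definition nb n m q : nat :=
  #|[set s : 'S_n.+1 | (s^-1 ord_max == q :> nat) && (s \in W n.+1 m)]|.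

Lemma nbE n m (i : 'I_n.+1) :
  nb n m i = #|[set s : 'S_n.+1 | (s i == ord_max) && (s \in W n.+1 m)]|.
Proof.
apply: eq_card => s; rewrite !inE; congr (_ && _).
by rewrite val_eqE; apply/eqP/eqP => [<-|<-]; rewrite ?permKV ?permK.
Qed.

Lemma sum_nb n m (P : pred nat) :
  #|[set s in W n.+1 m | P (s^-1 ord_max : 'I_n.+1)]| = \sum_(0 <= q < n.+1 | P q) nb n m q.
Proof.
rewrite -sum1_card big_mkord.
rewrite (partition_big (fun s : 'S_n.+1 => s^-1 ord_max) (fun q : 'I_n.+1 => P q)) /=.
  apply: eq_bigr => q Pq; rewrite sum1dep_card; apply: eq_card => s.
  by rewrite !inE val_eqE andbC; case: eqP => //= ->; rewrite Pq andbT.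
by move=> s; rewrite inE => /andP[].
Qed.

Lemma nb0 n q : nb n 0 q = 0.
Proof.
apply: eq_card0 => s; rewrite !inE cards_eq0; apply/negP => /andP[_ /eqP W0].
by have := in_set0 (ord0 : 'I_n.+1); rewrite -W0 inE leq0n.
Qed.

(** A maximum in last position is a fixed point, hence a weak excedance; deleting it leaves an
    arbitrary permutation. *)
Lemma nb_max n m : nb n.+1 m.+1 n.+1 = \sum_(0 <= q < n.+1) nb n m q.
Proof.
rewrite -(sum_nb n m xpredT) (@nbE _ _ ord_max) (card_perm_fixing _ ord_max).
apply: eq_card => t; rewrite !inE weak_excedances_lift ?leqnn ?leqnSn //.
by rewrite eqxx andbT.
Qed.

(** Only the value [i] distinguishes the conditions [i <= v] and [i + 1 <= v]. *)
Lemma card_weak_excedances_tperm n (i j : 'I_n) (s : 'S_n) :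
    j = i.+1 :> nat -> s i != i -> s j != i ->
  #|weak_excedances (tperm i j * s)| = #|weak_excedances s|.
Proof.
move=> ji; rewrite -!val_eqE /= => si sj.
rewrite -(card_preimset (weak_excedances s) (@perm_inj _ (tperm i j))).
apply: eq_card => x; rewrite !inE permM.
by case: tpermP => [->|->|//]; rewrite ji; lia.
Qed.

(* Exchanging the entries at [q] and [q.+1] moves the maximum between these two
   positions and preserves weak excedances unless the other entry is [q];
   in that case, the entry [q] can be deleted. *)
Lemma nb_swap n m q : q <= n ->
  nb n.+1 m.+1 q.+1 + nb n m.+1 q = nb n.+1 m.+1 q + nb n m q.
Proof.
move=> le_qn.
pose i : 'I_n.+2 := inord q; pose j : 'I_n.+2 := inord q.+1.
pose i' : 'I_n.+1 := inord q.
have iE : i = q :> nat by rewrite inordK // ltnS leqW.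
have jE : j = q.+1 :> nat by rewrite inordK.
have i'E : i' = q :> nat by rewrite inordK.
have ne_ij : i != j by rewrite -val_eqE /= iE jE neq_ltn ltnSn.
(* The deleted entry is a fixed point, so one weak excedance is lost. *)
have fixi (l : nat) : #|[set s : 'S_n.+2 | (s i == i) && ((s j == ord_max) && (s \in W n.+2 l.+1))]| = nb n l q.
  rewrite (card_perm_fixing _ i) -i'E nbE; apply: eq_card => t.
  rewrite !inE weak_excedances_lift ?leqnn ?leqnSn // eqxx add1n eqSS.
  have -> : j = lift i i' by apply: val_inj; rewrite /= /bump iE jE i'E leqnn.
  rewrite lift_perm_lift; congr (_ && _).
  have -> : (ord_max : 'I_n.+2) = lift i ord_max.
    by apply: val_inj; rewrite /= /bump iE le_qn.
  by rewrite (inj_eq lift_inj).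
(* Here the deleted entry lies below its index, so the count is kept. *)
have fixj (l : nat) : #|[set s : 'S_n.+2 | (s j == i) && ((s i == ord_max) && (s \in W n.+2 l))]| = nb n l q.
  rewrite (card_perm_fixing _ j) -i'E nbE; apply: eq_card => t.
  rewrite !inE weak_excedances_lift ?iE ?jE ?leqnn ?leqnSn // (eq_sym j) (negPf ne_ij) add0n.
  have {2}-> : i = lift j i' by apply: val_inj; rewrite /= /bump iE jE i'E ltnn.
  rewrite lift_perm_lift; congr (_ && _).
  have -> : (ord_max : 'I_n.+2) = lift i ord_max.
    by apply: val_inj; rewrite /= /bump iE le_qn.
  by rewrite (inj_eq lift_inj).
rewrite -(fixi m) -(fixj m.+1) -jE -iE !nbE.
set A := [set s : 'S_n.+2 | (s j == ord_max) && _].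
set B := [set s : 'S_n.+2 | (s i == ord_max) && _].
have cardI : #|A :\: [set s : 'S_n.+2 | s i == i]| = #|B :\: [set s : 'S_n.+2 | s j == i]|.
  rewrite -(card_preimset _ (mulgI (tperm i j))); apply: eq_card => s.
  rewrite !inE !permM tpermL tpermR.
  have [//|sj] := eqVneq (s j) i; have [si|//] := eqVneq (s i) ord_max.
  by rewrite card_weak_excedances_tperm ?iE ?jE // si -val_eqE /= iE; lia.
rewrite -(cardsID [set s : 'S_n.+2 | s i == i] A) -(cardsID [set s : 'S_n.+2 | s j == i] B).
rewrite cardI (setIC A) (setIC B).
have setI_pred (P Q : pred 'S_n.+2) : [set s | P s] :&: [set s | Q s] = [set s | P s && Q s].
  by apply/setP => s; rewrite !inE.
by rewrite !setI_pred addnAC [RHS]addnAC; congr (_ + _); rewrite addnC.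
Qed.

Lemma nb_cpred n m q : q <= n -> (nb n m q)%:Z%R = cpred n m q.
Proof.
elim: n m q => [|n IHn] [|m] q le_qn; rewrite ?nb0 //.
  move: le_qn; rewrite leqn0 => /eqP->.
  have -> : nb 0 m.+1 0 = (m == 0).
    rewrite (@nbE 0 m.+1 ord0).
    have W1 (s : 'S_1) : #|weak_excedances s| = 1%N.
      rewrite -[RHS](card_ord 1%N); apply: eq_card => x; rewrite !inE.
      by rewrite !(ord1 _) leqnn.
    case: m => [|m]; last first.
      by apply: eq_card0 => s; rewrite !inE W1 andbF.
    rewrite -[RHS](card_Sn 1%N); apply: eq_card => s.
    by rewrite !inE W1 !(ord1 _) !eqxx.
  (* With [n = 0] the convolved function is constantly 1, so [1 - x] cancels all but the coefficient
     at 0. *)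
  rewrite /= cE; case: m => [|m]; first by rewrite binomial_conv0.
  by rewrite binomial_convS !binomial_conv_bin0 !expr0 subrr.
(* Downward induction on [q], as induction on [d = n + 1 - q]. *)
rewrite -(subKn le_qn); move: (_ - q)%N (leq_subr q n.+1) => d.
elim: d => [_|d IHd lt_dn].
  rewrite subn0 nb_max /= c_split // [X in (X + _)%R]big_geq // add0r.
  rewrite (big_morph Posz PoszD (erefl _)).
  by apply: eq_big_nat => q' /andP[_ lt_q']; rewrite IHn.
have le_d : (n.+1 - d.+1 <= n)%N by lia.
have := congr1 Posz (@nb_swap n m _ le_d); rewrite !PoszD !IHn //.
rewrite -subSn // subSS IHd; last exact: ltnW.
have /= := @c_diff n m _ le_d; rewrite -subSn // subSS.
move: (c _ _ _) (c _ _ _) (c _ _ _) (cpred _ _ _) => a b c' d'; lia.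
Qed.

End Permutations.

Lemma QE n (s : 'S_n.+1) : Q s = ((s^-1)%g ord_max : 'I_n.+1).+1.
Proof.
rewrite /Q; case: pickP => [i|/(_ ((s^-1)%g ord_max))]; last by rewrite permKV eqxx.
rewrite eqSS => /eqP si; congr _.+1; congr val; apply: (@perm_inj _ s).
by rewrite permKV; apply: val_inj.
Qed.

Theorem theorem2p6 (n k j : nat) (hn : 0 < n) (hj : j <= n) :
  c n k j =
    (#|[set s in W n k.+1 | j < Q s <= n]|
     + #|[set s in W n k | 1 <= Q s <= j]|)%N%:Z%R.
Proof.
case: n hn hj => // n _ hj; rewrite c_split //.
(* [Q] counts from 1 and [s^-1 ord_max] from 0, so [j < Q s] becomes [j <=] the position. *)
have -> : [set s in W n.+1 k.+1 | j < Q s <= n.+1] =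
    [set s in W n.+1 k.+1 | leq j ((s^-1)%g ord_max : 'I_n.+1)].
  by apply/setP => s; rewrite !inE QE ltnS ltn_ord andbT.
have -> : [set s in W n.+1 k | 1 <= Q s <= j] =
    [set s in W n.+1 k | gtn j ((s^-1)%g ord_max : 'I_n.+1)].
  by apply/setP => s; rewrite !inE QE.
rewrite (sum_nb n k.+1 (leq j)) (sum_nb n k (gtn j)) PoszD.
rewrite !(big_morph Posz PoszD (erefl _)) /=; congr (_ + _)%R.
  rewrite [RHS](big_cat_nat (n := j)) //= [X in (X + _)%R]big1_seq ?add0r.
    rewrite [RHS]big_nat_cond [LHS]big_nat_cond; apply: eq_big => q.
      by case: (leqP j q) => //; rewrite ?andbT.
    by move=> /andP[/andP[_ lt_q] _]; rewrite (@nb_cpred n k.+1).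
  by move=> q; rewrite mem_index_iota; lia.
rewrite [RHS](big_cat_nat (n := j)) //= [X in (_ + X)%R]big1_seq ?addr0.
  rewrite [RHS]big_nat_cond [LHS]big_nat_cond; apply: eq_big => q.
    by case: (ltnP q j).
  by move=> /andP[/andP[_ lt_q] _]; rewrite -nb_cpred //; lia.
by move=> q; rewrite mem_index_iota; lia.
Qed.
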